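(* For every $C>0$ and every $\alpha\in[1/2,1)$ there exist positive constants $C_1,C_2,C_3$, depending only on $C$ and $\alpha$, such that the following holds for all integers $1\le m\le n-1$, all primes $p$, and all sets $E\subset\mathbb{F}_p^n$ satisfying $$|\widehat{E}(\xi)|\le C|E|^{\alpha}\quad\text{for all }\xi\in\mathbb{F}_p^n\setminus\{0\}.$$ (a) If $|E|\le C_1\,p^{\frac{m}{2-2\alpha}}$, then $|\pi^{W}(E)|\ge C_2|E|^{2-2\alpha}$ for all $W\in G(n,n-m)$. (b) If $|E|>C_1\,p^{\frac{m}{2-2\alpha}}$, then $|\pi^{W}(E)|\ge p^{m}/2$ for all $W\in G(n,n-m)$. (c) If $|E|>C_3\,p^{\frac{m}{1-\alpha}}$, then $|\pi^{W}(E)|=p^{m}$ for all $W\in G(n,n-m)$.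
   Context: $\mathbb{F}_p$ is the field with $p$ elements ($p$ prime). $|J|$ denotes the cardinality of a finite set $J$. $G(n,k)$ denotes the set of all $k$-dimensional linear subspaces of $\mathbb{F}_p^n$. For a subspace $W$ of $\mathbb{F}_p^n$ and $E\subset\mathbb{F}_p^n$, $\pi^W(E)$ is the set of cosets of $W$ that meet $E$: $$\pi^{W}(E)=\{x+W: x\in\mathbb{F}_p^n,\ E\cap(x+W)\ne\emptyset\}.$$ $\widehat{E}$ denotes the discrete Fourier transform of the characteristic function of $E$: $$\widehat{E}(\xi)=\sum_{x\in E}e^{-2\pi i\,(x\cdot\xi)/p},\qquad x\cdot\xi=x_1\xi_1+\cdots+x_n\xi_n \pmod p.$$ *)

(* Defs.v *)
From HB Require Import structures.
From mathcomp Require Import all_boot all_order all_algebra.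
From mathcomp Require Import complex.
From mathcomp Require Import reals exp trigo.

Set Implicit Arguments.
Unset Strict Implicit.
Unset Printing Implicit Defensive.

Import Order.TTheory GRing.Theory Num.Theory.

Local Open Scope ring_scope.
Local Open Scope complex_scope.

(* In this file p is an arbitrary natural number; 'F_p is the field with p
   elements only when p is prime, which has to be assumed by the users. *)

Definition grassmannian (p n k : nat) : {pred {vspace 'rV['F_p]_n}} :=
  [pred W : {vspace 'rV['F_p]_n} | \dim W == k].
Arguments grassmannian p n k : clear implicits.

Definition vcoset (p n : nat) (W : {vspace 'rV['F_p]_n}) (x : 'rV['F_p]_n) :
  {set 'rV['F_p]_n} := [set x + w | w in W].

Definition vproj (p n : nat) (W : {vspace 'rV['F_p]_n})
    (E : {set 'rV['F_p]_n}) : {set {set 'rV['F_p]_n}} :=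
  [set vcoset W x | x : 'rV['F_p]_n & E :&: vcoset W x != set0].

Definition dotp (p n : nat) (x y : 'rV['F_p]_n) : 'F_p :=
  \sum_(i < n) x 0 i * y 0 i.

Definition expi (R : realType) (t : R) : R[i] := cos t +i* sin t.

(* The residue x . xi is represented by its value in {0, ..., p - 1}; the
   choice of representative is irrelevant since expi is 2 pi-periodic. *)
Definition fourier (R : realType) (p n : nat) (E : {set 'rV['F_p]_n})
    (xi : 'rV['F_p]_n) : R[i] :=
  \sum_(x in E) expi (- (2 * pi * (nat_of_ord (dotp x xi))%:R / p%:R)).
Arguments fourier R {p n} E xi.

(* Main.v *)
(* Write W as the kernel of a surjection x |-> x A onto F_p^m, so that the
   cosets of W are the fibers and the orthogonal of W is { eta A^T }.  By Parseval the
   fiber sizes f(y) = |{x in E : x A = y}| satisfy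
     p^m sum_y f(y)^2 = sum_eta |E^(eta A^T)|^2
                      <= |E|^2 + p^m C^2 |E|^(2 alpha),
   and Cauchy-Schwarz, |E|^2 <= |pi^W(E)| sum_y f(y)^2, gives
     p^m |E|^(2-2 alpha) <= |pi^W(E)| (|E|^(2-2 alpha) + C^2 p^m).
   (a) and (b) are the two cases according to which summand dominates.  For (c),
   Fourier inversion writes p^m f(y) as |E| plus an error of size less than
   p^m C |E|^alpha, so no fiber is empty. *)

Require Import Defs.
From mathcomp Require Import all_boot all_order all_algebra.
From mathcomp Require Import complex.
From mathcomp Require Import reals exp trigo.
From mathcomp Require Import ring lra.

Import Order.TTheory GRing.Theory Num.Theory.

Local Open Scope ring_scope.
Local Open Scope complex_scope.

(** * Additive characters of F_p *)

Lemma expi0 (R : realType) : expi (0 : R) = 1.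
Proof. by rewrite /expi cos0 sin0. Qed.

Lemma expiD (R : realType) (s t : R) : expi (s + t) = expi s * expi t.
Proof. by rewrite /expi cosD sinD [sin s * _ + _]addrC. Qed.

Lemma conj_expi (R : realType) (t : R) : (expi t)^* = expi (- t).
Proof. by rewrite /expi cosN sinN. Qed.

Lemma norm_expi (R : realType) (t : R) : `|expi t| = 1.
Proof. by rewrite normc_def /= cos2Dsin2 sqrtr1. Qed.

Definition addchar (R : realType) (p : nat) (a : 'F_p) : R[i] :=
  expi (- (2 * pi * (nat_of_ord a)%:R / p%:R)).
Arguments addchar R {p} a.

(** Any natural representative of a residue gives the same value, because [expi] has period 2 pi.
    Additivity of [addchar] then needs no carries modulo p. *)
Lemma addchar_nat (R : realType) (p k : nat) : prime p ->
  addchar R (k%:R : 'F_p) = expi (- (2 * pi * k%:R / p%:R)).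
Proof.
move=> pr_p; rewrite /addchar val_Fp_nat //.
have p_neq0 : p%:R != 0 :> R by rewrite pnatr_eq0 -lt0n prime_gt0.
have periodic j : expi (- (2 * pi * j%:R)) = 1.
  elim: j => [|j IHj]; first by rewrite mulr0 oppr0 expi0.
  rewrite -[j.+1]addn1 [(j + 1)%:R]natrD mulrDr mulr1 opprD expiD IHj mul1r.
  rewrite -conj_expi /expi.
  by rewrite mulr_natl cos2pi sin2pi conjc1.
have -> : k%:R = (k %/ p)%:R * p%:R + (k %% p)%:R :> R.
  by rewrite -natrM -natrD -divn_eq.
rewrite [2 * pi * (_ + _)]mulrDr [(_ + _) / _]mulrDl opprD expiD.
by rewrite mulrA mulfK // periodic mul1r.
Qed.

Lemma addchar0 (R : realType) (p : nat) : addchar R (0 : 'F_p) = 1.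
Proof. by rewrite /addchar mulr0 mul0r oppr0 expi0. Qed.

Lemma addcharD (R : realType) (p : nat) (a b : 'F_p) : prime p ->
  addchar R (a + b) = addchar R a * addchar R b.
Proof.
move=> pr_p; rewrite -[a]natr_Zp -[b]natr_Zp -natrD !addchar_nat //.
by rewrite -expiD natrD [2 * pi * (_ + _)]mulrDr [(_ + _) / _]mulrDl opprD.
Qed.

Lemma norm_addchar (R : realType) (p : nat) (a : 'F_p) : `|addchar R a| = 1.
Proof. exact: norm_expi. Qed.

(** Both sides are the inverse of [addchar R a], which has modulus 1. *)
Lemma conj_addchar (R : realType) (p : nat) (a : 'F_p) : prime p ->
  Num.conj (addchar R a) = addchar R (- a).
Proof.
move=> pr_p; have nz : addchar R a != 0 by rewrite -normr_gt0 norm_addchar.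
apply: (mulfI nz); rewrite -normCK norm_addchar expr1n.
by rewrite -addcharD // subrr addchar0.
Qed.

(** Since p >= 2, the angle 2 pi / p lies in ]0, pi], where the cosine is injective and so differs
    from cos 0. *)
Lemma addchar1_neq1 (R : realType) (p : nat) : prime p ->
  addchar R (1 : 'F_p) != 1.
Proof.
move=> pr_p; rewrite -[1]/(1%:R) addchar_nat // mulr1.
have p_gt0 : 0 < p%:R :> R by rewrite ltr0n prime_gt0.
have p_ge2 : 2 <= p%:R :> R by rewrite ler_nat prime_gt1.
have t_gt0 : 0 < 2 * pi / p%:R :> R by rewrite divr_gt0 ?mulr_gt0 ?pi_gt0.
have t_le : 2 * pi / p%:R <= pi :> R.
  by rewrite ler_pdivrMr // mulrC ler_wpM2l ?pi_ge0.
apply/eqP => -[]; rewrite cosN -[RHS]cos0 => /cos_inj H _.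
by have := t_gt0; rewrite H ?ltxx // in_itv /= ?lexx ?pi_ge0 ?(ltW t_gt0).
Qed.

(** * The dot product and orthogonality of characters *)

Lemma dotpDl (p n : nat) (x y z : 'rV['F_p]_n) :
  dotp (x + y) z = dotp x z + dotp y z.
Proof. by rewrite -big_split; apply: eq_bigr => i _; rewrite mxE mulrDl. Qed.

Lemma dotpDr (p n : nat) (x y z : 'rV['F_p]_n) :
  dotp z (x + y) = dotp z x + dotp z y.
Proof. by rewrite -big_split; apply: eq_bigr => i _; rewrite mxE mulrDr. Qed.

Lemma dotpNl (p n : nat) (x y : 'rV['F_p]_n) :
  dotp (- x) y = - dotp x y.
Proof. by rewrite -sumrN; apply: eq_bigr => i _; rewrite mxE mulNr. Qed.

Lemma dotp_mulmx (p n : nat) (x y : 'rV['F_p]_n) :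
  dotp x y = (x *m y^T) 0 0.
Proof. by rewrite mxE; apply: eq_bigr => i _; rewrite mxE. Qed.

Lemma dotp_adjoint (p m n : nat) (A : 'M['F_p]_(n, m)) (x : 'rV_n) (y : 'rV_m) :
  dotp x (y *m A^T) = dotp (x *m A) y.
Proof. by rewrite !dotp_mulmx trmx_mul trmxK mulmxA. Qed.

(* For y <> 0, translating eta by some eta0 with y . eta0 = 1 multiplies the sum
   by addchar 1 <> 1. *)
Lemma addchar_orthogonality (R : realType) (p m : nat) (y : 'rV['F_p]_m) :
  prime p ->
  \sum_(eta : 'rV['F_p]_m) addchar R (dotp y eta) =
    if y == 0 then (p ^ m)%:R else 0.
Proof.
move=> pr_p; case: eqP => [-> | /eqP y_neq0].
  rewrite (eq_bigr (fun=> 1)) => [|eta _]; last first.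
    by rewrite dotp_mulmx mul0mx mxE addchar0.
  by rewrite sumr_const card_mx card_Fp // mul1n.
have [i yi_neq0] : exists i, y 0 i != 0.
  by apply/existsP; apply: contra_neqT y_neq0 => /existsPn y0;
     apply/rowP => i; rewrite mxE; apply/eqP/negPn/y0.
pose eta0 : 'rV['F_p]_m := (y 0 i)^-1 *: delta_mx 0 i.
have dot_eta0 : dotp y eta0 = 1.
  rewrite /dotp (bigD1 i) //= big1 => [|j ji].
    by rewrite !mxE !eqxx mulr1 divff // addr0.
  by rewrite !mxE (negbTE ji) andbF !mulr0.
set S := \sum_eta _.
have shift : addchar R (1 : 'F_p) * S = S.
  rewrite {2}/S (reindex_inj (addrI eta0)) mulr_sumr /=.
  by apply: eq_bigr => eta _; rewrite dotpDr addcharD // dot_eta0.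
apply/eqP; have /eqP := shift; rewrite -subr_eq0 -{2}[S]mul1r -mulrBl mulf_eq0.
by rewrite subr_eq0 (negbTE (addchar1_neq1 R p pr_p)).
Qed.

(** * Fourier analysis of the fibers of x |-> x A *)

Lemma fourierE (R : realType) (p n : nat) (E : {set 'rV['F_p]_n}) xi :
  fourier R E xi = \sum_(x in E) addchar R (dotp x xi).
Proof. by []. Qed.

Lemma fourier0 (R : realType) (p n : nat) (E : {set 'rV['F_p]_n}) :
  fourier R E 0 = #|E|%:R.
Proof.
rewrite fourierE (eq_bigr (fun=> 1)) => [|x _]; first by rewrite sumr_const.
by rewrite dotp_mulmx trmx0 mulmx0 mxE addchar0.
Qed.

(** After exchanging the sums, each x in E contributes the sum over eta of the character at (x A -
    y) . eta, which orthogonality evaluates to p^m or 0. *)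
Lemma fiber_inversion (R : realType) (p m n : nat) (A : 'M['F_p]_(n, m))
    (E : {set 'rV['F_p]_n}) (y : 'rV['F_p]_m) : prime p ->
  \sum_(eta : 'rV['F_p]_m)
      addchar R (- dotp y eta) * fourier R E (eta *m A^T) =
    (p ^ m)%:R * #|[set x in E | x *m A == y]|%:R.
Proof.
move=> pr_p.
under eq_bigr => eta _ do rewrite fourierE mulr_sumr.
rewrite exchange_big /= -sum1_card natr_sum mulr_sumr.
rewrite [RHS](eq_bigl (fun x => (x \in E) && (x *m A == y))) => [|x]; last first.
  by rewrite inE.
rewrite [RHS]big_mkcondr /=; apply: eq_bigr => x _.
rewrite mulr1 -(subr_eq0 (x *m A)) -addchar_orthogonality //.
apply: eq_bigr => eta _.
by rewrite -addcharD // dotp_adjoint dotpDl dotpNl addrC.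
Qed.

Lemma fiber_parseval (R : realType) (p m n : nat) (A : 'M['F_p]_(n, m))
    (E : {set 'rV['F_p]_n}) : prime p ->
  \sum_(eta : 'rV['F_p]_m) `|fourier R E (eta *m A^T)| ^+ 2 =
    (p ^ m * \sum_(y : 'rV['F_p]_m) #|[set x in E | x *m A == y]| ^ 2)%:R.
Proof.
move=> pr_p; pose f (y : 'rV['F_p]_m) := #|[set x in E | x *m A == y]|.
(* Expanding only the conjugate factor of the squared modulus leaves, for each x in E, the inversion
   sum at y = x A. *)
transitivity (\sum_(x in E) \sum_(eta : 'rV['F_p]_m)
    addchar R (- dotp (x *m A) eta) * fourier R E (eta *m A^T)).
  rewrite exchange_big /=; apply: eq_bigr => eta _.
  rewrite normCK mulrC {1}fourierE rmorph_sum mulr_suml.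
  by apply: eq_bigr => x _; rewrite /= conj_addchar // dotp_adjoint.
under eq_bigr => x _ do rewrite fiber_inversion // -/(f _).
rewrite -mulr_sumr natrM -natr_sum; congr (_ * _%:R).
(* Grouping the x in E by y = x A, the value f(y) occurs f(y) times. *)
rewrite (partition_big (fun x => x *m A) xpredT) //=.
apply: eq_bigr => y _; rewrite (eq_bigr (fun=> f y)) => [|x /andP[_ /eqP->] //].
rewrite sum_nat_const -mulnn; congr (_ * _)%N.
by apply: eq_card => x; rewrite !inE.
Qed.

Lemma cauchy_schwarz_card (R : realType) (T : finType) (A : {set T})
    (f : T -> R) :
  (\sum_(i in A) f i) ^+ 2 <= #|A|%:R * \sum_(i in A) f i ^+ 2.
Proof.
set N := \sum_(i in A) f i; set Q := \sum_(i in A) _.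
have [A0 | A_gt0] := posnP #|A|.
  by rewrite /N (cards0_eq A0) big_set0 expr0n /= cards0 mul0r.
have k_gt0 : 0 < #|A|%:R :> R by rewrite ltr0n.
set k : R := #|A|%:R in k_gt0 *.
(* The variance of f on A, scaled by k to avoid dividing by the cardinal. *)
have : 0 <= \sum_(i in A) (k * f i - N) ^+ 2.
  by apply: sumr_ge0 => i _; exact: sqr_ge0.
have -> : \sum_(i in A) (k * f i - N) ^+ 2 = k * (k * Q - N ^+ 2).
  rewrite (eq_bigr (fun i => k ^+ 2 * f i ^+ 2 + - (2 * k * N) * f i + N ^+ 2)).
    rewrite !big_split /= -!mulr_sumr -/N -/Q sumr_const -mulr_natl -/k.
    ring.
  by move=> i _; ring.
by rewrite pmulr_rge0 // subr_ge0.
Qed.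

(** * Subspaces as kernels of surjective matrices *)

Lemma subspace_equations (F : fieldType) (m n : nat) (W : {vspace 'rV[F]_n}) :
  (m <= n)%N -> \dim W = (n - m)%N ->
  exists (A : 'M[F]_(n, m)) (S : 'M[F]_(m, n)),
    S *m A = 1%:M /\ forall x, (x \in W) = (x *m A == 0).
Proof.
move=> le_mn dimW.
pose B := \matrix_(i < \dim W) (vbasis W)`_i.
have mulB (c : 'rV_(\dim W)) : c *m B = \sum_i c 0 i *: (vbasis W)`_i.
  by rewrite mulmx_sum_row; apply: eq_bigr => i _; rewrite rowK.
have B_free : row_free B.
  apply: inj_row_free => c; rewrite mulB => c0; apply/rowP => i; rewrite mxE.
  have /freeP free_W := basis_free (vbasisP W); exact: (free_W (c 0) c0).
have memW x : (x \in W) = (x <= B)%MS.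
  apply/idP/submxP => [xW | [c ->]]; last first.
    rewrite mulB; apply: memv_suml => i _; apply: memvZ.
    by apply: vbasis_mem; rewrite mem_nth // size_tuple.
  exists (\row_i coord (vbasis W) i x); rewrite mulB {1}(coord_vbasis xW).
  by apply: eq_bigr => i _; rewrite mxE.
(* The kernel of [cokermx B] is the row space of [B], that is W. A basis of its columns gives n - (n
   - m) = m independent equations, and full column rank gives the section [S]. *)
have rk : \rank (cokermx B) = m.
  by rewrite mxrank_coker (eqP B_free) dimW subKn.
have [S SA] := row_fullP (col_base_full (cokermx B)).
have mem_col x : (x \in W) = (x *m col_base (cokermx B) == 0).
  rewrite memW submxE -{1}(mulmx_base (cokermx B)) mulmxA.
  by rewrite mulmx_free_eq0 ?row_base_free.
(* The rank occurs in the types of these matrices, so they are generalized before it is replaced by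
   m. *)
move: (col_base _) S SA mem_col; rewrite rk => A S SA mem_col.
by exists A, S.
Qed.

(** Cosets of W are the fibers [g y], and [g] is injective because [y *m S] belongs to [g y] and to
    no other fiber. *)
Lemma card_vproj (p m n : nat) (W : {vspace 'rV['F_p]_n})
    (A : 'M['F_p]_(n, m)) (S : 'M['F_p]_(m, n)) (E : {set 'rV['F_p]_n}) :
  S *m A = 1%:M -> (forall x, (x \in W) = (x *m A == 0)) ->
  #|vproj W E| = #|[set x *m A | x in E]|.
Proof.
move=> SA memW; pose g (y : 'rV['F_p]_m) := [set x : 'rV['F_p]_n | x *m A == y].
have vcosetE x : vcoset W x = g (x *m A).
  apply/setP => z; rewrite inE; apply/imsetP/eqP => [[w] | zx].
    by rewrite memW => /eqP w0 ->; rewrite mulmxDl w0 addr0.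
  exists (z - x); last by rewrite addrC subrK.
  by rewrite memW mulmxBl zx subrr.
have g_inj : injective g.
  move=> y z /setP/(_ (y *m S)).
  by rewrite !inE -mulmxA SA mulmx1 eqxx => /esym/eqP.
rewrite -(card_imset _ g_inj); congr #|pred_of_set _|.
apply/setP => c; apply/imsetP/imsetP => [[x] | [_ /imsetP[x xE ->] ->]].
  rewrite inE => /set0Pn[z]; rewrite vcosetE !inE => /andP[zE /eqP zx] ->.
  exists (x *m A); last by [].
  by apply/imsetP; exists z.
exists x; last by rewrite vcosetE.
rewrite inE; apply/set0Pn; exists x.
by rewrite vcosetE !inE xE eqxx.
Qed.

(** Transposing S A = 1 gives a right inverse of A^T. Thus the decay hypothesis on the Fourier
    transform applies at eta A^T for every nonzero eta. *)
Lemma mulmx_tr_section_neq0 (F : fieldType) (m n : nat) (A : 'M[F]_(n, m))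
    (S : 'M[F]_(m, n)) (eta : 'rV[F]_m) :
  S *m A = 1%:M -> eta != 0 -> eta *m A^T != 0.
Proof.
move=> SA; apply: contra_neq => eta0.
by rewrite -[eta]mulmx1 -trmx1 -SA trmx_mul mulmxA eta0 mul0mx.
Qed.

(** * The size of the image of E under x |-> x A *)

Lemma card_proj_lower_bound (R : realType) (p m n : nat) (A : 'M['F_p]_(n, m))
    (E : {set 'rV['F_p]_n}) (B : R) : prime p ->
  (forall eta : 'rV['F_p]_m, eta != 0 -> `|fourier R E (eta *m A^T)| <= B%:C) ->
  #|E|%:R ^+ 2 * (p ^ m)%:R <=
    #|[set x *m A | x in E]|%:R * (#|E|%:R ^+ 2 + (p ^ m)%:R * B ^+ 2).
Proof.
move=> pr_p bound; pose f (y : 'rV['F_p]_m) := #|[set x in E | x *m A == y]|.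
set Y := [set x *m A | x in E].
have P_gt0 : 0 < (p ^ m)%:R :> R by rewrite ltr0n expn_gt0 prime_gt0.
have sum_f : #|E|%:R = \sum_(y in Y) (f y)%:R :> R.
  rewrite -natr_sum -sum1_card (partition_big_imset (fun x => x *m A)) /=.
  congr _%:R; apply: eq_bigr => y _; rewrite /f -sum1_card.
  by apply: eq_bigl => x; rewrite inE.
have energy : (p ^ m)%:R * (\sum_y f y ^ 2)%:R
    <= #|E|%:R ^+ 2 + (p ^ m)%:R * B ^+ 2 :> R.
  (* The inequality is moved into R[i] to use Parseval. The frequency 0 contributes |E|^2, and the
     others, at most p^m in number, at most B^2 each. *)
  rewrite -lecR -natrM rmorph_nat -(fiber_parseval R) // (bigD1 0) //=.
  rewrite mul0mx fourier0 normr_nat rmorphD rmorphXn /= rmorph_nat lerD2l.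
  apply: (@le_trans _ _ (\sum_(eta : 'rV['F_p]_m | eta != 0) (B ^+ 2)%:C)).
    apply: ler_sum => eta /bound; rewrite rmorphXn /= => le_B.
    by rewrite lerXn2r // ?nnegrE // (le_trans _ le_B).
  rewrite sumr_const (rmorphM _ (p ^ m)%:R) /= rmorph_nat -[leLHS]mulr_natl.
  rewrite ler_wpM2r ?ler0c ?sqr_ge0 // ler_nat.
  rewrite -[X in (X ^ m)%N](card_Fp pr_p) -[m in (_ ^ m)%N]mul1n.
  by rewrite -card_mx max_card.
have := cauchy_schwarz_card R _ Y (fun y => (f y)%:R); rewrite -sum_f => CS.
have Q_le : \sum_(y in Y) (f y)%:R ^+ 2 <= (\sum_y f y ^ 2)%:R :> R.
  rewrite natr_sum [leRHS](bigID [in Y]) /= -[leLHS]addr0.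
  under eq_bigr => y _ do rewrite -natrX.
  by rewrite lerD // sumr_ge0.
rewrite mulrC; apply: (le_trans (ler_wpM2l (ltW P_gt0) CS)).
rewrite mulrCA ler_wpM2l //; apply: le_trans energy.
by rewrite ler_pM2l.
Qed.

(** At an empty fiber the inversion sum vanishes, so its eta = 0 term, |E|, is cancelled by the
    others, whose total modulus is at most p^m B. *)
Lemma proj_surjective (R : realType) (p m n : nat) (A : 'M['F_p]_(n, m))
    (E : {set 'rV['F_p]_n}) (B : R) : prime p -> 0 <= B ->
  (forall eta : 'rV['F_p]_m, eta != 0 -> `|fourier R E (eta *m A^T)| <= B%:C) ->
  (p ^ m)%:R * B < #|E|%:R ->
  [set x *m A | x in E] = [set: 'rV_m].
Proof.
move=> pr_p B_ge0 bound E_large; apply/setP => y; rewrite [RHS]inE.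
apply: contraTT E_large => y_notin; rewrite -leNgt.
have fiber0 : [set x in E | x *m A == y] = set0.
  apply/setP => x; rewrite !inE; apply: contraNF y_notin => /andP[xE /eqP <-].
  exact: imset_f.
have := fiber_inversion R p m n A E y pr_p; rewrite fiber0 cards0 mulr0.
rewrite (bigD1 0) //= mul0mx fourier0 [dotp y 0]dotp_mulmx trmx0 mulmx0 mxE.
rewrite oppr0 addchar0 mul1r => /eqP; rewrite addr_eq0 => /eqP E_eq.
rewrite -lecR rmorph_nat -(normr_nat R[i]) E_eq normrN.
apply: le_trans (ler_norm_sum _ _ _) _.
apply: (@le_trans _ _ (\sum_(eta : 'rV['F_p]_m | eta != 0) B%:C)).
  by apply: ler_sum => eta /bound; rewrite normrM norm_addchar mul1r.
rewrite sumr_const rmorphM rmorph_nat -[leLHS]mulr_natl.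
rewrite ler_wpM2r ?ler0c // ler_nat.
rewrite -[X in (X ^ m)%N](card_Fp pr_p) -[m in (_ ^ m)%N]mul1n.
by rewrite -card_mx max_card.
Qed.

(** * Real exponents and the three thresholds *)

Lemma powR_root_lt (R : realType) (a b s : R) : 0 < s -> 0 <= a -> 0 <= b ->
  a `^ s^-1 < b -> a < b `^ s.
Proof.
move=> s_gt0 a_ge0 b_ge0 ab; rewrite -[a]powRr1 // -(mulVf (lt0r_neq0 s_gt0)).
by rewrite powRrM gt0_ltr_powR // nnegrE ?powR_ge0.
Qed.

Lemma powR_root_ge (R : realType) (a b s : R) : 0 < s -> 0 <= a -> 0 <= b ->
  b <= a `^ s^-1 -> b `^ s <= a.
Proof.
move=> s_gt0 a_ge0 b_ge0 ab; rewrite -[a]powRr1 // -(mulVf (lt0r_neq0 s_gt0)).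
by rewrite powRrM ge0_ler_powR ?nnegrE ?powR_ge0 ?(ltW s_gt0).
Qed.

Theorem proposition1p7 (R : realType) (C alpha : R)
    (C_gt0 : 0 < C) (alpha_ge : 1 / 2 <= alpha) (alpha_lt1 : alpha < 1) :
  exists C1 C2 C3 : R, [/\ 0 < C1, 0 < C2, 0 < C3 &
    forall (m n p : nat) (E : {set 'rV['F_p]_n}),
      (1 <= m <= n - 1)%N -> prime p ->
      (forall xi : 'rV['F_p]_n, xi != 0 ->
         `|fourier R E xi| <= (C * #|E|%:R `^ alpha)%:C) ->
      [/\ (* (a) *)
          #|E|%:R <= C1 * p%:R `^ (m%:R / (2 - 2 * alpha)) ->
          forall W : {vspace 'rV['F_p]_n}, W \in grassmannian p n (n - m) ->
            C2 * #|E|%:R `^ (2 - 2 * alpha) <= #|vproj W E|%:R,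
          (* (b) *)
          C1 * p%:R `^ (m%:R / (2 - 2 * alpha)) < #|E|%:R ->
          forall W : {vspace 'rV['F_p]_n}, W \in grassmannian p n (n - m) ->
            p%:R ^+ m / 2 <= #|vproj W E|%:R :> R
        & (* (c) *)
          C3 * p%:R `^ (m%:R / (1 - alpha)) < #|E|%:R ->
          forall W : {vspace 'rV['F_p]_n}, W \in grassmannian p n (n - m) ->
            #|vproj W E| = (p ^ m)%N]].
Proof.
pose s : R := 2 - 2 * alpha; pose r : R := 1 - alpha.
have r_gt0 : 0 < r by rewrite subr_gt0.
have s_gt0 : 0 < s by rewrite /s; move: r_gt0; rewrite /r; lra.
have C2_gt0 : 0 < C ^+ 2 by rewrite exprn_gt0.
(* The first constant turns the threshold of (a) and (b) into a comparison of |E|^s with C^2 p^m,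
   the two summands in [key]. The third turns that of (c) into C p^m < |E|^r. *)
exists ((C ^+ 2) `^ s^-1), (2 * C ^+ 2)^-1, (C `^ r^-1).
split; rewrite ?powR_gt0 ?invr_gt0 ?mulr_gt0 // => m n p E m_range pr_p hE.
have le_mn : (m <= n)%N.
  by case/andP: m_range => _ /leq_trans; apply; rewrite leq_subr.
rewrite -/s -/r; set N : R := #|E|%:R in hE *; set P : R := (p ^ m)%:R.
have N_ge0 : 0 <= N by exact: ler0n.
have P_gt0 : 0 < P by rewrite ltr0n expn_gt0 prime_gt0.
have threshold (c t : R) : 0 <= c ->
    c `^ t^-1 * p%:R `^ (m%:R / t) = (c * P) `^ t^-1.
  move=> c_ge0; rewrite powRM ?(ltW P_gt0) //.
  by rewrite powRrM powR_mulrn // /P natrX.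
rewrite !threshold ?(ltW C_gt0) ?(ltW C2_gt0) //.
have key W : W \in grassmannian p n (n - m) -> N `^ s * P <=
    #|vproj W E|%:R * (N `^ s + C ^+ 2 * P).
  rewrite inE => /eqP dimW.
  have [A [S [SA memW]]] := subspace_equations _ _ _ W le_mn dimW.
  rewrite (card_vproj _ _ _ _ _ _ E SA memW).
  (* Empty E is treated apart, since the factor |E|^(2 alpha) is cancelled below. *)
  have [->|N_neq0] := eqVneq N 0.
    by rewrite powR0 ?gt_eqF // mul0r mulr_ge0 // add0r mulr_ge0 // ltW.
  have N_gt0 : 0 < N by rewrite lt_def N_neq0.
  have := card_proj_lower_bound R p m n A E (C * N `^ alpha) pr_p
    (fun eta nz => hE _ (mulmx_tr_section_neq0 _ _ _ _ _ eta SA nz)).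
  rewrite -/N -/P.
  have -> : N ^+ 2 = N `^ s * (N `^ alpha) ^+ 2.
    rewrite -!powR_mulrn ?powR_ge0 // -powRrM -powRD ?N_neq0 ?implybT //.
    by congr (_ `^ _); rewrite /s; ring.
  have v_gt0 : 0 < (N `^ alpha) ^+ 2 by rewrite exprn_gt0 ?powR_gt0.
  move=> le_K; rewrite -(ler_pM2r v_gt0); apply: le_trans (le_trans le_K _).
    by rewrite mulrAC.
  by rewrite le_eqVlt; apply/orP; left; apply/eqP; ring.
split=> [N_small W /key | N_large W /key | N_large W].
- have u_le : N `^ s <= C ^+ 2 * P.
    by apply: powR_root_ge => //; rewrite mulr_ge0 // ltW.
  move=> le_K; rewrite ler_pdivrMl ?mulr_gt0 // -(ler_pM2r P_gt0).
  apply: (le_trans le_K); set K : R := #|_|%:R.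
  (* The dominant summand is doubled, which is the source of the 2 in the second constant and of the
     1/2 in (b). *)
  have -> : 2 * C ^+ 2 * K * P = K * (C ^+ 2 * P + C ^+ 2 * P) by ring.
  by rewrite ler_wpM2l ?ler0n // lerD2r.
- have u_gt : C ^+ 2 * P < N `^ s.
    by apply: powR_root_lt => //; rewrite mulr_ge0 // ltW.
  have u_gt0 : 0 < N `^ s by apply: le_lt_trans u_gt; rewrite mulr_ge0 // ltW.
  move=> le_K; rewrite -natrX -/P ler_pdivrMr // -(ler_pM2l u_gt0).
  apply: (le_trans le_K); set K : R := #|_|%:R.
  have -> : N `^ s * (K * 2) = K * (N `^ s + N `^ s) by ring.
  by rewrite ler_wpM2l ?ler0n // lerD2l ltW.
- rewrite inE => /eqP dimW.
  have [A [S [SA memW]]] := subspace_equations _ _ _ W le_mn dimW.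
  rewrite (card_vproj _ _ _ _ _ _ E SA memW).
  have N_gt0 : 0 < N by apply: le_lt_trans N_large; rewrite powR_ge0.
  have u_gt : C * P < N `^ r.
    by apply: powR_root_lt => //; rewrite mulr_ge0 // ltW.
  rewrite (proj_surjective R p m n A E (C * N `^ alpha)) //.
  + by rewrite cardsT card_mx card_Fp // mul1n.
  + by rewrite mulr_ge0 ?powR_ge0 // ltW.
  + by move=> eta nz; apply/hE/(mulmx_tr_section_neq0 _ _ _ _ _ eta SA nz).
  rewrite -/N -/P mulrCA mulrA.
  (* Cancelling |E|^alpha reduces the hypothesis p^m B < |E| to [u_gt]. *)
  have N_split : N = N `^ r * N `^ alpha.
    rewrite -powRD ?(gt_eqF N_gt0) ?implybT //.
    by rewrite /r subrK powRr1.
  by rewrite [ltRHS]N_split ltr_pM2r ?powR_gt0.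
Qed.
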